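(* Let $N\ge 2$, $T\ge1$, $\alpha\in(0,1)$, $\eta>0$, and define the Tsallis entropy $S_\alpha(p)=\frac{1}{1-\alpha}\big(1-\sum_{i=1}^N p_i^\alpha\big)$ for $p\in\Delta_N$ and $\tilde\Phi(G)=\max_{p\in\Delta_N}\{\langle p,G\rangle-\eta S_\alpha(p)\}$. Then for every loss sequence $g_1,\dots,g_T\in[-1,0]^N$ fixed in advance, the algorithm GBPA$(\tilde\Phi)$ has expected regret \[\mathbb{E}\,\mathrm{Regret}_T\le \eta\,\frac{N^{1-\alpha}-1}{1-\alpha}+\frac{N^\alpha T}{2\eta\alpha}.\]
   Context: $\Delta_N$ is the probability simplex in $\mathbb{R}^N$, $e_i$ the standard basis vector. Algorithm GBPA$(\tilde\Phi)$: set $\hat G_0=0$; for $t=1,\dots,T$: sample arm $i_t$ according to $p_t=\nabla\tilde\Phi(\hat G_{t-1})$; incur and observe only $g_{t,i_t}$; set $\hat G_t=\hat G_{t-1}+\frac{g_{t,i_t}}{p_{t,i_t}}e_{i_t}$. Regret is $\mathrm{Regret}_T=\max_{i}\sum_{t=1}^T(g_{t,i}-g_{t,i_t})$ and the expectation is over the algorithm's sampling. *)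

(* Defs.v *)
From HB Require Import structures.
From mathcomp Require Import all_boot all_order all_algebra.
From mathcomp Require Import all_classical all_reals all_analysis.
Set Implicit Arguments. Unset Strict Implicit. Unset Printing Implicit Defensive.
Import Order.TTheory GRing.Theory Num.Theory.
Import numFieldNormedType.Exports.
Local Open Scope classical_set_scope.
Local Open Scope ring_scope.

Section GBPA.
Variables (R : realType) (N : nat).

Definition simplex : set ('I_N -> R) :=
  [set p | (forall i, 0 <= p i) /\ \sum_(i < N) p i = 1].

Definition tsallis (alpha : R) (p : 'I_N -> R) : R :=
  (1 - \sum_(i < N) (p i `^ alpha)) / (1 - alpha).

Definition PhiT (alpha eta : R) (G : 'I_N -> R) : R :=
  sup [set v | exists2 p, simplex p & v = \sum_(i < N) p i * G i - eta * tsallis alpha p].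

Definition gradPhiT (alpha eta : R) (G : 'I_N -> R) (i : 'I_N) : R :=
  derive1 (fun h : R => PhiT alpha eta (fun j => G j + h * (j == i)%:R)) 0.

(* Histories are stored newest-first: i :: s means arm i was played at
   time (size s) (times are 0-based) after history s. *)
Fixpoint Ghat (alpha eta : R) (g : nat -> 'I_N -> R) (s : seq 'I_N) : 'I_N -> R :=
  match s with
  | [::] => fun _ => 0
  | i :: s' =>
      let G := Ghat alpha eta g s' in
      fun j => G j + (if j == i then g (size s') i / gradPhiT alpha eta G i else 0)
  end.

Fixpoint histProb (alpha eta : R) (g : nat -> 'I_N -> R) (s : seq 'I_N) : R :=
  match s with
  | [::] => 1
  | i :: s' => gradPhiT alpha eta (Ghat alpha eta g s') i * histProb alpha eta g s'
  end.

(* Regret_T for the chronological sequence of arms x (x_t played at time t). *)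
Definition regret (T : nat) (g : nat -> 'I_N -> R) (x : T.-tuple 'I_N) : R :=
  sup (range (fun i : 'I_N => \sum_(t < T) (g t i - g t (tnth x t)))).

Definition expected_regret (alpha eta : R) (T : nat) (g : nat -> 'I_N -> R) : R :=
  \sum_(x : T.-tuple 'I_N) histProb alpha eta g (rev x) * regret g x.

End GBPA.

(* Main.v *)
Require Import Defs.
From mathcomp Require Import all_boot all_order all_algebra.
From mathcomp Require Import all_classical all_reals all_analysis.
From mathcomp Require Import ring lra.
Import Order.TTheory GRing.Theory Num.Theory.
Import numFieldNormedType.Exports.
Local Open Scope ring_scope.

Set Implicit Arguments.
Unset Strict Implicit.
Unset Printing Implicit Defensive.

(** The maximiser [p] of [<q, G> - eta S_alpha(q)] over the simplex is interior:
    it satisfies [G i = l - eta alpha / (1 - alpha) p_i^(alpha - 1)], where the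
    multiplier [l] is found by the intermediate value theorem.  Keeping [l] fixed
    while coordinate [i] of [G] moves by [x] separates the variables in the
    Lagrangian, so the increment of [PhiT] is controlled by a one-dimensional
    inequality for [u^alpha].  That inequality shows at once that the gradient of
    [PhiT] is [p], and that for [x <= 0] the second-order error is at most
    [x^2 p_i^(2 - alpha) / (2 eta alpha)].  With [x = g_i / p_i], averaging over
    [i] leaves [sum_i p_i^(1 - alpha) / (2 eta alpha) <= N^alpha / (2 eta alpha)]
    per round.  Hence, for a fixed arm [i], the expectation of
    [PhiT Ghat - Ghat i + (regret against i)] grows by at most that much per round;
    it starts at [PhiT 0] and dominates the expected regret, since
    [Ghat i <= PhiT Ghat]. *)

(** * One-variable inequalities for [u^a] *)

Section PowerInequalities.
Variables (R : realType).
Implicit Types a u p q x z c : R.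

(** From [1 + y <= expR y] at [y = - b * ln u], followed by [ln u <= u - 1]. *)
Lemma powRN_ge_affine b u : 0 <= b -> 0 < u -> 1 + b * (1 - u) <= u `^ (- b).
Proof.
move=> b0 u0; rewrite /powR gt_eqF//.
apply: le_trans (expR_ge1Dx _); rewrite lerD2l mulNr -mulrN ler_wpM2l//.
have := @le_ln1Dx R (u - 1); rewrite (addrC 1) subrK => /(_ _)/wrap[]; lra.
Qed.

Lemma powR_le_quadratic a u : 0 < a < 1 -> 0 <= u <= 1 ->
  u `^ a <= 1 - a * (1 - u) - a * (1 - a) / 2 * (1 - u) ^+ 2.
Proof.
move=> /andP[a0 a1] /andP[]; rewrite le_eqVlt => /predU1P[<- _|u0 u1].
  by rewrite powR0 ?gt_eqF//; nra.
(* Since [f 1 = 1], monotonicity suffices; [0 <= f'] is [powRN_ge_affine] with exponent [1 - a]. The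
   endpoint [0], where [x^a] is not differentiable, was treated apart. *)
pose f (x : R) := x `^ a + (a * (1 - x) + a * (1 - a) / 2 * (1 - x) ^+ 2).
suff : f u <= f 1 by rewrite /f powR1 /=; lra.
have df x : 0 < x -> is_derive x 1 f
    (a * x `^ (a - 1) + (- a - a * (1 - a) * (1 - x))).
  move=> x0; have ? := is_derive1_powR a x0.
  by apply: is_derive_eq; rewrite /GRing.scale/=; field.
have fle := @ger0_derive1_le_cc R f u 1.
apply: fle; rewrite ?in_itv/= ?lexx ?u1//.
- move=> x; rewrite in_itv/= => /andP[ux _].
  by have [] := df x (lt_trans u0 ux).
- move=> x; rewrite in_itv/= => /andP[ux x1]; rewrite derive1E.
  have x0 := lt_trans u0 ux; have [_ ->] := df x x0.
  have b1 : 0 <= 1 - a by lra.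
  have := powRN_ge_affine b1 x0; rewrite opprB.
  nra.
- apply: derivable_within_continuous => x; rewrite in_itv/= => /andP[ux _].
  by have [] := df x (lt_le_trans u0 ux).
Qed.

Lemma powR_invr a u : 0 <= u -> u^-1 `^ a = (u `^ a)^-1.
Proof. by move=> u0; rewrite -powR_inv1// powRAC powR_inv1 ?powR_ge0. Qed.

(* This is [powR_le_quadratic] for the exponent [1 - a] at [1 / u], multiplied by [u]. *)
Lemma powR_le_quadratic_ge1 a u : 0 < a < 1 -> 1 <= u ->
  u `^ a <= 1 + a * (u - 1) - a * (1 - a) / 2 * ((u - 1) ^+ 2 / u).
Proof.
move=> a01 u1; have u0 : 0 < u by lra.
have b01 : 0 < 1 - a < 1 by lra.
have v01 : 0 <= u^-1 <= 1 by rewrite invr_ge0 ltW//= invf_le1.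
have := powR_le_quadratic b01 v01.
rewrite -(@ler_pM2l _ u)// powR_invr ?(ltW u0)// -powRN opprB.
rewrite mulr_powRB1 ?(ltW u0)//; last by case/andP: a01.
move=> /le_trans; apply; rewrite le_eqVlt; apply/orP; left; apply/eqP; field.
by rewrite gt_eqF.
Qed.

Lemma powR_le_tangent1 a u : 0 < a < 1 -> 0 <= u -> u `^ a <= 1 + a * (u - 1).
Proof.
move=> a01 u0; have k0 : 0 <= a * (1 - a) / 2 by nra.
have [u1|u1] := leP u 1.
  have /(_ _)/wrap[] := @powR_le_quadratic a u a01; first by rewrite u0.
  by move=> /le_trans; apply; have := mulr_ge0 k0 (sqr_ge0 (1 - u)); lra.
have := powR_le_quadratic_ge1 a01 (ltW u1).
move=> /le_trans; apply.
have Q0 : 0 <= (u - 1) ^+ 2 / u by rewrite divr_ge0 ?sqr_ge0.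
by have := mulr_ge0 k0 Q0; lra.
Qed.

(** By homogeneity of the power; this carries estimates at base point [1] over to any [p > 0]. *)
Lemma powR_scale_tangent a p q : 0 < p -> 0 <= q ->
  q `^ a - p `^ a - a * p `^ (a - 1) * (q - p) =
  p `^ a * ((q / p) `^ a - 1 - a * (q / p - 1)).
Proof.
move=> p0 q0; rewrite powRM ?invr_ge0 ?(ltW p0)// powR_invr ?(ltW p0)//.
rewrite powRB ?(gt_eqF p0) ?implybT// powRr1 ?(ltW p0)//; field.
by rewrite !gt_eqF// powR_gt0.
Qed.

Lemma powR_le_tangent a p q : 0 < a < 1 -> 0 < p -> 0 <= q ->
  q `^ a <= p `^ a + a * p `^ (a - 1) * (q - p).
Proof.
move=> a01 p0 q0.
have := powR_le_tangent1 a01 (divr_ge0 q0 (ltW p0)).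
have := powR_scale_tangent a p0 q0; have := powR_gt0 a p0.
set X := _ `^ a; nra.
Qed.

(* For [u <= 1] the right-hand side is least at [z = a (1 - a) (1 - u)], where the
   claim is [powR_le_quadratic]. *)
Lemma powR_bregman_nneg a u z : 0 < a < 1 -> 0 <= u -> 0 <= z ->
  u `^ a - 1 - a * (u - 1) <= z * (u - 1) + z ^+ 2 / (2 * (a * (1 - a))).
Proof.
move=> a01 u0 z0; have k0 : 0 < a * (1 - a) by nra.
have [u1|u1] := leP u 1; last first.
  have : 0 <= z ^+ 2 / (2 * (a * (1 - a))).
    by rewrite divr_ge0 ?sqr_ge0// mulr_ge0// ltW.
  by have := powR_le_tangent1 a01 u0; nra.
have /(_ _)/wrap[] := @powR_le_quadratic a u a01; first by rewrite u0.
have : 0 <= (z - a * (1 - a) * (1 - u)) ^+ 2 / (2 * (a * (1 - a))).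
  by rewrite divr_ge0 ?sqr_ge0// mulr_ge0// ltW.
have -> : (z - a * (1 - a) * (1 - u)) ^+ 2 / (2 * (a * (1 - a))) =
  z ^+ 2 / (2 * (a * (1 - a))) + z * (u - 1) + a * (1 - a) / 2 * (1 - u) ^+ 2.
  by field; rewrite !gt_eqF//; lra.
lra.
Qed.

Lemma powR_bregman_npos a u z : 0 < a < 1 -> 0 <= u ->
    - (a * (1 - a) / 4) <= z <= 0 ->
  u `^ a - 1 - a * (u - 1) <= z * (u - 1) + z ^+ 2 / (a * (1 - a)).
Proof.
move=> a01 u0 z0; have k0 : 0 < a * (1 - a) by nra.
have Z0 : 0 <= z ^+ 2 / (a * (1 - a)) by rewrite divr_ge0 ?sqr_ge0// ltW.
have [u1|u1] := leP u 1.
  by have := powR_le_tangent1 a01 u0; nra.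
have := powR_le_quadratic_ge1 a01 (ltW u1).
have ui : 0 < u^-1 <= 1 by rewrite invr_gt0 invf_le1; lra.
set k := a * (1 - a) in k0 z0 Z0 *.
have D0 : u != 0 by rewrite gt_eqF//; lra.
(* Half of the quadratic gain [k / 2 * ((u - 1)^2 / u)] completes a square with [z]; the other half
   pays for the remainder because [- k / 4 <= z]. *)
have S1 : 0 <= (k * (u - 1) / 2 + z) ^+ 2 / k / u.
  by rewrite !divr_ge0 ?sqr_ge0// ltW.
have S2 : 0 <= (z + k / 4) * ((u - 1) ^+ 2 / u).
  by rewrite mulr_ge0 ?divr_ge0 ?sqr_ge0//; lra.
have S3 : 0 <= z ^+ 2 / k * (1 - u^-1) by rewrite mulr_ge0//; lra.
have : z * (u - 1) + k / 2 * ((u - 1) ^+ 2 / u) + z ^+ 2 / k =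
  (k * (u - 1) / 2 + z) ^+ 2 / k / u + (z + k / 4) * ((u - 1) ^+ 2 / u)
  + z ^+ 2 / k * (1 - u^-1).
  by field; rewrite D0 gt_eqF.
lra.
Qed.

End PowerInequalities.

(** * The regularised maximum and its stationary point *)

Section Potential.
Variables (R : realType) (N : nat) (a eta : R).
Hypotheses (a01 : 0 < a < 1) (eta0 : 0 < eta).
Implicit Types (G p q : 'I_N -> R) (i j : 'I_N) (x l : R).

Let c := eta / (1 - a).

Let c0 : 0 < c. Proof. by rewrite divr_gt0//; have := a01; lra. Qed.

Let a1 : 1 - a != 0. Proof. by apply/eqP; have := a01; lra. Qed.

Definition objective G q := \sum_(i < N) q i * G i - eta * tsallis a q.

(** Minus the Bregman divergence of the convex function [- c * u^a], hence nonpositive. *)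
Definition bregman (r s : R) := c * (s `^ a - r `^ a - a * r `^ (a - 1) * (s - r)).

Lemma bregman_le0 (r s : R) : 0 < r -> 0 <= s -> bregman r s <= 0.
Proof.
move=> r0 s0; have := powR_le_tangent a01 r0 s0.
by rewrite /bregman (pmulr_rle0 _ c0); lra.
Qed.

(** Put [u = s / r] and multiply by [c * r^a]. The constant [K] is left free because the two signs
    of [x] get different constants. *)
Lemma bregman_le_scaled (r s x K : R) : 0 < r -> 0 <= s ->
  (forall u z, 0 <= u -> z = - x * r `^ (1 - a) / c ->
     u `^ a - 1 - a * (u - 1) <= z * (u - 1) + K * z ^+ 2) ->
  bregman r s + x * (s - r) <= K * x ^+ 2 * r `^ (2 - a) / c.
Proof.
move=> r0 s0 /(_ (s / r) _ (divr_ge0 s0 (ltW r0)) erefl).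
rewrite /bregman powR_scale_tangent//.
have ra := powR_gt0 a r0.
have E1 : r `^ (1 - a) = r / r `^ a.
  by rewrite powRB ?(gt_eqF r0) ?implybT// powRr1 ?(ltW r0).
have -> : r `^ (2 - a) = r * (r / r `^ a).
  rewrite -E1 -[X in X * _](@powRr1 _ r) ?(ltW r0)//.
  by rewrite -powRD ?(gt_eqF r0) ?implybT//; congr (_ `^ _); lra.
rewrite E1.
rewrite -(ler_pM2l (mulr_gt0 c0 ra)); set P := r `^ a in ra *.
set L := _ `^ a - 1 - _ => h.
suff : c * P * (- x * (r / P) / c * (s / r - 1) + K * (- x * (r / P) / c) ^+ 2)
  = - (x * (s - r)) + K * x ^+ 2 * (r * (r / P)) / c by lra.
by field; rewrite !gt_eqF.
Qed.

Definition is_gibbs G p l := [/\ forall i, 0 < p i, \sum_(i < N) p i = 1 &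
  forall i, G i = l - c * (a * p i `^ (a - 1))].

Lemma is_gibbs_simplex G p l : is_gibbs G p l -> simplex p.
Proof. by case=> p0 p1 _; split=> // i; exact/ltW. Qed.

Lemma objectiveE G q : objective G q = \sum_(i < N) (q i * G i + c * q i `^ a) - c.
Proof.
rewrite /objective /tsallis big_split/= -mulr_sumr /c; field.
exact: a1.
Qed.

(** Stationarity turns [G] into the first-order term of each [bregman]; the multiplier drops out
    because [p] and [q] have equal sums. *)
Lemma objective_gibbs G p l q : is_gibbs G p l -> simplex q ->
  objective G q = objective G p + \sum_(i < N) bregman (p i) (q i).
Proof.
move=> [p0 p1 Gp] [q0 q1]; rewrite !objectiveE.
rewrite [in LHS](eq_bigr (fun i => p i * G i + c * p i `^ a
  + (bregman (p i) (q i) + l * (q i - p i)))); last first.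
  by move=> i _; rewrite /bregman Gp; ring.
have E : \sum_(i < N) l * (q i - p i) = 0.
  by rewrite -mulr_sumr sumrB p1 q1 subrr mulr0.
by rewrite !big_split/= E /c; ring.
Qed.

Lemma objective_le_gibbs G p l q : is_gibbs G p l -> simplex q ->
  objective G q <= objective G p.
Proof.
move=> Gp sq; rewrite (objective_gibbs Gp sq) gerDl sumr_le0// => i _.
by case: Gp sq => p0 _ _ [q0 _]; exact: bregman_le0.
Qed.

(** Shaped so that the update in [Ghat] folds to it by conversion. *)
Definition shift_coord G i x j := G j + (if j == i then x else 0).

Lemma objective_shift G i x q : objective (shift_coord G i x) q = objective G q + x * q i.
Proof.
rewrite /objective [in LHS](eq_bigr (fun j => q j * G j + (if j == i then x * q j else 0))).
  by rewrite big_split/= -big_mkcond/= big_pred1_eq; ring.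
by move=> j _; rewrite /shift_coord; case: eqP => _; ring.
Qed.

(** The shift meets coordinate [i] alone; the other divergence terms are nonpositive and are
    dropped. *)
Lemma objective_shift_le G p l i x q B : is_gibbs G p l -> simplex q ->
  bregman (p i) (q i) + x * (q i - p i) <= B ->
  objective (shift_coord G i x) q <= objective G p + x * p i + B.
Proof.
move=> Gp sq hB; rewrite objective_shift (objective_gibbs Gp sq) (bigD1 i)//=.
suff : \sum_(j < N | j != i) bregman (p j) (q j) <= 0 by lra.
apply: sumr_le0 => j _.
by case: Gp sq => p0 _ _ [q0 _]; exact: bregman_le0.
Qed.

Lemma PhiT_le_ub G B : (exists q : 'I_N -> R, simplex q) ->
  (forall q, simplex q -> objective G q <= B) -> PhiT a eta G <= B.
Proof.
move=> [q0 sq0] h; apply: ge_sup; first by exists (objective G q0), q0.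
by move=> _ [q sq ->]; exact: h.
Qed.

Lemma PhiT_gibbs G p l : is_gibbs G p l -> PhiT a eta G = objective G p.
Proof.
move=> Gp; have sp := is_gibbs_simplex Gp; apply/eqP; rewrite eq_le; apply/andP; split.
  by apply: PhiT_le_ub => [|q]; [exists p|exact: objective_le_gibbs Gp].
apply: ub_le_sup; last by exists p.
by exists (objective G p) => _ [q sq ->]; exact: objective_le_gibbs Gp sq.
Qed.

Lemma gibbs_exists G : (0 < N)%N -> exists p l, is_gibbs G p l.
Proof.
move=> N0; have N0' : 0 < N%:R :> R by rewrite ltr0n.
have aa := a01; pose k := c * a; have k0 : 0 < k by rewrite mulr_gt0//; lra.
pose i0 := Ordinal N0.
case: (@Order.TotalTheory.arg_maxP _ _ _ i0 xpredT G erefl) => m _ mmax.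
have Gm j : G j <= G m by exact: mmax.
(* [P j l] is the stationarity equation [G j = l - k * p^(a - 1)] solved for [p]. *)
pose b := (1 - a)^-1; have b0 : 0 < b by rewrite invr_gt0; lra.
pose P j l := ((l - G j) / k) `^ (- b).
(* At [L] the term of the largest coordinate [m] is already [1]; at [U] every term is at most
   [1 / N]. So the sum crosses [1] in between. *)
pose L := G m + k; pose U := G m + k * N%:R `^ (1 - a).
have N1 : 1 <= N%:R `^ (1 - a) :> R.
  have : 1 `^ (1 - a) <= N%:R `^ (1 - a) :> R.
    by apply: ge0_ler_powR; rewrite ?nnegrE ?ler1n//; lra.
  by rewrite powR1.
have LU : L <= U by rewrite lerD2l ler_pMr.
have pos j l : L <= l -> 0 < (l - G j) / k.
  move=> Ll; rewrite divr_gt0//; have := Gm j; rewrite /L in Ll; lra.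
have [] := @IVT R (\sum_(j < N) P j) L U 1 LU.
- apply: derivable_within_continuous => l; rewrite in_itv/= => /andP[Ll _].
  apply: derivable_sum => j.
  have D1 : is_derive l 1 (fun l => (l - G j) / k) k^-1.
    by apply: is_derive_eq; rewrite /GRing.scale/=; ring.
  have D2 := is_derive1_powR (- b) (pos j l Ll).
  by have [] := @is_derive1_comp R _ (fun l => (l - G j) / k) l _ _ D2 D1.
- rewrite ge_min le_max !fct_sumE; apply/andP; split; apply/orP; [right|left].
    have -> : 1 = \sum_(j < N) N%:R^-1 :> R.
      by rewrite sumr_const card_ord -[RHS]mulr_natr mulVf// gt_eqF.
    apply: ler_sum => j _; rewrite /P powRN.
    have UG : N%:R `^ (1 - a) <= (U - G j) / k.
      by rewrite ler_pdivlMr//; have := Gm j; rewrite /U; lra.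
    rewrite lef_pV2 ?posrE ?powR_gt0//; last exact: pos.
    have -> : N%:R = (N%:R `^ (1 - a)) `^ b :> R.
      by rewrite -powRrM divff// powRr1.
    apply: ge0_ler_powR; rewrite ?nnegrE ?powR_ge0 ?(ltW b0)//.
    exact/ltW/pos.
  rewrite (bigD1 m)//= /P /L addrAC subrr add0r divff ?gt_eqF// powR1.
  by rewrite lerDl sumr_ge0// => j _; exact: powR_ge0.
move=> l; rewrite in_itv/= => /andP[Ll _]; rewrite fct_sumE => S1.
exists (fun j => P j l), l; split=> //.
  by move=> j; rewrite powR_gt0// pos.
move=> j; rewrite /P -powRrM.
have -> : - b * (a - 1) = 1 by rewrite /b; field.
rewrite powRr1; last exact/ltW/pos.
by rewrite mulrA -/k [k * _]mulrC divfK ?gt_eqF//; ring.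
Qed.

Lemma gibbs_le1 G p l i : is_gibbs G p l -> p i <= 1.
Proof.
move=> [p0 <- _]; rewrite (bigD1 i)//= lerDl sumr_ge0// => j _; exact/ltW.
Qed.

Lemma gibbs_powR_le1 G p l i b : is_gibbs G p l -> 0 <= b -> p i `^ b <= 1.
Proof.
move=> Gp b0; have [p0 _ _] := Gp.
have : p i `^ b <= 1 `^ b.
  by apply: ge0_ler_powR; rewrite ?nnegrE ?(ltW (p0 i))// (gibbs_le1 _ Gp).
by rewrite powR1.
Qed.

(** * Increments and gradient of the potential *)

Lemma PhiT_ge G q : simplex q -> objective G q <= PhiT a eta G.
Proof.
move=> sq; have N0 : (0 < N)%N.
  case: sq => _; case: (posnP N) => // N0; move: q; rewrite N0 => q.
  by rewrite big_ord0 => /esym/eqP; rewrite oner_eq0.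
have [p [l Gp]] := gibbs_exists G N0.
by rewrite (PhiT_gibbs Gp); exact: objective_le_gibbs Gp sq.
Qed.

(** The old maximiser [p] remains a feasible competitor after the shift. *)
Lemma PhiT_shift_ge G p l i x : is_gibbs G p l ->
  PhiT a eta G + x * p i <= PhiT a eta (shift_coord G i x).
Proof.
move=> Gp; rewrite (PhiT_gibbs Gp) -objective_shift.
exact: PhiT_ge (is_gibbs_simplex Gp).
Qed.

(** Importance-weighted losses are nonpositive but can be large, so no smallness of [x] is assumed.
    Here [z = - x * p_i^(1 - a) / c >= 0], and [powR_bregman_nneg] applies. *)
Lemma PhiT_shift_le_npos G p l i x : is_gibbs G p l -> x <= 0 ->
  PhiT a eta (shift_coord G i x) <=
  PhiT a eta G + x * p i + x ^+ 2 * p i `^ (2 - a) / (2 * eta * a).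
Proof.
move=> Gp x0; have [p0 _ _] := Gp; have aa := a01.
rewrite (PhiT_gibbs Gp); apply: PhiT_le_ub.
  by exists p; exact: is_gibbs_simplex Gp.
move=> q sq; apply: (objective_shift_le Gp sq).
have -> : x ^+ 2 * p i `^ (2 - a) / (2 * eta * a) =
    (2 * (a * (1 - a)))^-1 * x ^+ 2 * p i `^ (2 - a) / c.
  by rewrite /c; field; rewrite a1 !gt_eqF//; lra.
apply: bregman_le_scaled => //; first by case: sq.
move=> u z u0 zE; rewrite [_^-1 * _]mulrC; apply: powR_bregman_nneg => //.
rewrite zE; apply: divr_ge0; last exact: ltW.
by rewrite mulr_ge0 ?powR_ge0//; lra.
Qed.

(** Supplies the right-hand side of the two-sided derivative, for which small [x] and a cruder
    constant suffice. *)
Lemma PhiT_shift_le_nneg G p l i x : is_gibbs G p l ->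
  0 <= x <= c * (a * (1 - a) / 4) ->
  PhiT a eta (shift_coord G i x) <=
  PhiT a eta G + x * p i + x ^+ 2 / (eta * a).
Proof.
move=> Gp /andP[x0 xs]; have [p0 _ _] := Gp; have aa := a01.
have p1 b := @gibbs_powR_le1 _ _ _ i b Gp.
have k0 : 0 < a * (1 - a) by nra.
rewrite (PhiT_gibbs Gp); apply: PhiT_le_ub.
  by exists p; exact: is_gibbs_simplex Gp.
move=> q sq; apply: (objective_shift_le Gp sq).
apply: (@le_trans _ _ ((a * (1 - a))^-1 * x ^+ 2 * p i `^ (2 - a) / c)); last first.
  have -> : x ^+ 2 / (eta * a) = (a * (1 - a))^-1 * x ^+ 2 * 1 / c.
    by rewrite /c; field; rewrite a1 !gt_eqF//; lra.
  rewrite ler_pM2r ?invr_gt0// ler_wpM2l//; last by apply: p1; lra.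
  by rewrite mulr_ge0 ?sqr_ge0// invr_ge0 ltW.
apply: bregman_le_scaled => //; first by case: sq.
move=> u z u0 zE; rewrite [_^-1 * _]mulrC; apply: powR_bregman_npos => //.
have /andP[z0 zx] : 0 <= x * p i `^ (1 - a) / c <= a * (1 - a) / 4.
  apply/andP; split; first by rewrite divr_ge0 ?(ltW c0)// mulr_ge0 ?powR_ge0.
  rewrite ler_pdivrMr// [leRHS]mulrC (le_trans _ xs)//.
  have /p1 : 0 <= 1 - a by lra.
  nra.
by rewrite zE !mulNr; lra.
Qed.

(** The increment of [PhiT] minus [h * p i] lies between [0] and [h^2 / (eta * a)] for small [h], so
    the difference quotient tends to [p i]. *)
Lemma gradPhiT_gibbs G p l i : is_gibbs G p l -> gradPhiT a eta G i = p i.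
Proof.
move=> Gp; rewrite /gradPhiT /derive1; have aa := a01.
have sE h : (fun j => G j + h * (j == i)%:R) = shift_coord G i h.
  by apply/funext => j; rewrite /shift_coord; case: eqP => _; rewrite ?mulr1 ?mulr0.
have s0 : shift_coord G i 0 = G.
  by apply/funext => j; rewrite /shift_coord; case: eqP => _; rewrite addr0.
pose d := c * (a * (1 - a) / 4); have d0 : 0 < d by rewrite mulr_gt0//; nra.
have C0 : 0 < eta * a by rewrite mulr_gt0//; lra.
apply: cvg_lim; first exact: Rhausdorff.
apply/cvgrPdist_le => e e0.
near=> h; rewrite addr0 !sE s0 /GRing.scale/=.
have hd : `|h| <= d by near: h; exact: dnbhs0_le.
have he : `|h| <= e * (eta * a) by near: h; apply: dnbhs0_le; rewrite mulr_gt0.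
have h0 : h != 0 by near: h; exact: nbhs_dnbhs_neq.
have lo := PhiT_shift_ge i h Gp.
have up : PhiT a eta (shift_coord G i h) <= PhiT a eta G + h * p i + h ^+ 2 / (eta * a).
  have [h1|h1] := leP 0 h.
    by apply: PhiT_shift_le_nneg Gp _; rewrite h1 -/d (le_trans (ler_norm h) hd).
  apply: le_trans (PhiT_shift_le_npos i Gp (ltW h1)) _; rewrite lerD2l.
  have a2 : 0 <= 2 - a by lra.
  have P1 := gibbs_powR_le1 i Gp a2.
  have H2 : 0 <= h ^+ 2 / (eta * a) by rewrite divr_ge0 ?sqr_ge0// ltW.
  have -> : h ^+ 2 * p i `^ (2 - a) / (2 * eta * a) =
      h ^+ 2 / (eta * a) * (p i `^ (2 - a) / 2).
    by field; rewrite !gt_eqF//; lra.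
  by have := powR_ge0 (p i) (2 - a); nra.
set D := PhiT a eta (shift_coord G i h) - PhiT a eta G.
have -> : p i - h^-1 * D = - (D - h * p i) / h by field.
rewrite normrM normrN normfV ler_pdivrMr ?normr_gt0//.
have hh : h ^+ 2 = `|h| * `|h| by rewrite -expr2 real_normK// num_real.
rewrite ger0_norm /D; last lra.
have : h ^+ 2 / (eta * a) <= e * `|h|.
  by rewrite hh ler_pdivrMr// mulrAC ler_wpM2r.
lra.
Unshelve. all: by end_near. Qed.

End Potential.

(** * Initial value of the potential and its expected growth in one round *)

Section Regret.
Variables (R : realType) (N : nat) (a eta : R).
Hypotheses (N0 : (0 < N)%N) (a01 : 0 < a < 1) (eta0 : 0 < eta).
Implicit Types (G p q : 'I_N -> R) (i j k : 'I_N).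

(** Take tangents at the uniform point [1 / N]: their linear parts sum to zero. Used with [b = a]
    for the initial value and [b = 1 - a] for each round. *)
Lemma sum_powR_simplex_le (b : R) p : 0 < b < 1 -> simplex p ->
  \sum_(i < N) p i `^ b <= N%:R `^ (1 - b).
Proof.
move=> b01 [p0 p1]; have N0' : 0 < N%:R :> R by rewrite ltr0n.
have Ni0 : 0 < N%:R^-1 :> R by rewrite invr_gt0.
pose r : R := N%:R^-1.
apply: (@le_trans _ _ (\sum_(i < N) (r `^ b + b * r `^ (b - 1) * (p i - r)))).
  by apply: ler_sum => i _; exact: powR_le_tangent.
rewrite big_split/= -mulr_sumr sumrB p1 !sumr_const card_ord.
rewrite -[r *+ N]mulr_natr mulVf ?gt_eqF// subrr mulr0 addr0.
rewrite /r powR_invr ?ler0n// powRB ?(gt_eqF N0') ?implybT// powRr1 ?ler0n//.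
by rewrite -[leLHS]mulr_natl.
Qed.

Lemma PhiT0_le : PhiT a eta (fun _ : 'I_N => 0) <=
  eta * ((N%:R `^ (1 - a) - 1) / (1 - a)).
Proof.
have [p [l Gp]] := gibbs_exists a01 eta0 (fun _ : 'I_N => 0) N0.
apply: PhiT_le_ub; first by exists p; exact: is_gibbs_simplex Gp.
move=> q sq; rewrite /objective big1 ?sub0r; last by move=> i _; rewrite mulr0.
rewrite -mulrN ler_pM2l// /tsallis -mulNr opprB ler_pM2r ?invr_gt0; last first.
  by have := a01; lra.
by rewrite lerD2r; exact: sum_powR_simplex_le.
Qed.

Lemma gradPhiT_simplex G :
  (forall i, 0 < gradPhiT a eta G i) /\ \sum_(i < N) gradPhiT a eta G i = 1.
Proof.
have [p [l Gp]] := gibbs_exists a01 eta0 G N0; have [p0 p1 _] := Gp.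
split=> [i|]; first by rewrite (gradPhiT_gibbs a01 eta0 i Gp).
by rewrite -p1; apply: eq_bigr => i _; exact: gradPhiT_gibbs Gp.
Qed.

Lemma expected_PhiT_step G (v : 'I_N -> R) : (forall i, -1 <= v i <= 0) ->
  \sum_(i < N) gradPhiT a eta G i *
      PhiT a eta (shift_coord G i (v i / gradPhiT a eta G i)) <=
  PhiT a eta G + \sum_(i < N) gradPhiT a eta G i * v i
    + N%:R `^ a / (2 * eta * a).
Proof.
move=> v01; have [p [l Gp]] := gibbs_exists a01 eta0 G N0.
have aa := a01; have [p0 p1 _] := Gp.
have C0 : 0 < 2 * eta * a by rewrite !mulr_gt0//; lra.
rewrite (eq_bigr (fun i => p i * PhiT a eta (shift_coord G i (v i / p i)))); last first.
  by move=> i _; rewrite (gradPhiT_gibbs a01 eta0 i Gp).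
rewrite [X in _ + X + _](eq_bigr (fun i => p i * v i)); last first.
  by move=> i _; rewrite (gradPhiT_gibbs a01 eta0 i Gp).
apply: (@le_trans _ _ (\sum_(i < N)
   (p i * PhiT a eta G + p i * v i + p i `^ (1 - a) / (2 * eta * a)))).
  apply: ler_sum => i _; have pi0 := p0 i.
  have x0 : v i / p i <= 0.
    by rewrite pmulr_lle0 ?invr_gt0//; have := v01 i; lra.
  apply: le_trans (ler_wpM2l (ltW pi0) (PhiT_shift_le_npos a01 eta0 i Gp x0)) _.
  have P0 := powR_gt0 (1 - a) pi0.
  have -> : p i `^ (2 - a) = p i * p i `^ (1 - a).
    rewrite -[X in X * _](@powRr1 _ (p i)) ?(ltW pi0)//.
    by rewrite -powRD ?(gt_eqF pi0) ?implybT//; congr (_ `^ _); lra.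
  (* The sampling weight [p i] and the power [p_i^(2 - a)] absorb the [p_i^-2] of the squared
     estimate, leaving [p_i^(1 - a)]. *)
  have -> : p i * (PhiT a eta G + v i / p i * p i +
      (v i / p i) ^+ 2 * (p i * p i `^ (1 - a)) / (2 * eta * a)) =
    p i * PhiT a eta G + p i * v i
      + v i ^+ 2 * (p i `^ (1 - a) / (2 * eta * a)).
    by field; rewrite !gt_eqF//; lra.
  rewrite lerD2l ler_piMl//; first by rewrite divr_ge0 ?(ltW P0) ?(ltW C0).
  by have := v01 i; nra.
rewrite !big_split/= -!mulr_suml p1 mul1r lerD2l ler_pM2r ?invr_gt0//.
have b01 : 0 < 1 - a < 1 by lra.
have := sum_powR_simplex_le b01 (is_gibbs_simplex Gp).
by rewrite subKr.
Qed.

End Regret.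

(** * Expectation over histories and the potential argument *)

Section Histories.
Variables (R : realType) (N : nat) (a eta : R) (g : nat -> 'I_N -> R).
Hypotheses (N0 : (0 < N)%N) (a01 : 0 < a < 1) (eta0 : 0 < eta).
Implicit Types (i j k : 'I_N) (s : seq 'I_N).

(* As in [Ghat], histories are newest-first. *)
Fixpoint regret_against i s : R :=
  if s is k :: s' then g (size s') i - g (size s') k + regret_against i s' else 0.

Lemma regret_against_rev i s :
  regret_against i s = \sum_(t < size s) (g t i - g t (nth i (rev s) t)).
Proof.
elim: s => [|k s IH] /=; first by rewrite big_ord0.
rewrite big_ord_recr/= rev_cons nth_rcons size_rev ltnn eqxx addrC IH.
congr (_ + _); apply: eq_bigr => t _.
by rewrite nth_rcons size_rev ltn_ord.
Qed.

Definition history_potential i s : R :=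
  PhiT a eta (Ghat a eta g s) - Ghat a eta g s i + regret_against i s.

(** On average [PhiT] gains at most the mean of [v] plus the error, [Ghat i] gains [v i] by
    unbiasedness, and the regret gains [v i] minus that mean: the linear terms cancel. *)
Lemma history_potential_step i s :
  (forall k, -1 <= g (size s) k <= 0) ->
  \sum_(k < N) gradPhiT a eta (Ghat a eta g s) k * history_potential i (k :: s)
  <= history_potential i s + N%:R `^ a / (2 * eta * a).
Proof.
move=> g01; set G := Ghat a eta g s; set v := g (size s) in g01 *.
have [p0 p1] := gradPhiT_simplex N0 a01 eta0 G.
have step := expected_PhiT_step N0 a01 eta0 G g01.
rewrite (eq_bigr (fun k => gradPhiT a eta G k *
    PhiT a eta (shift_coord G k (v k / gradPhiT a eta G k))
  + gradPhiT a eta G k * (v i + regret_against i s - G i)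
  - gradPhiT a eta G k * v k - (if k == i then v i else 0))); last first.
  move=> k _; rewrite /history_potential/= -/G -/v -/(shift_coord G k _).
  rewrite [i == k]eq_sym; case: eqP => [->|_]; last by ring.
  by field; rewrite gt_eqF.
rewrite sumrB sumrB big_split/= -mulr_suml p1 mul1r -big_mkcond/= big_pred1_eq.
by rewrite /history_potential -/G; lra.
Qed.

(** [F] acts on sequences of any length, so one functional can be followed from round to round. *)
Definition history_expectation n (F : seq 'I_N -> R) : R :=
  \sum_(s : n.-tuple 'I_N) histProb a eta g s * F s.

Lemma histProb_ge0 s : 0 <= histProb a eta g s.
Proof.
elim: s => //= k s IH; rewrite mulr_ge0// ltW//.
by have [] := gradPhiT_simplex N0 a01 eta0 (Ghat a eta g s).
Qed.

Lemma history_expectation0 F : history_expectation 0 F = F [::].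
Proof.
rewrite /history_expectation (big_pred1 [tuple]) /= ?mul1r// => t.
by apply/esym/eqP; exact: tuple0.
Qed.

(** The tower rule: the head of a history is its latest arm, so conditioning is on the tail. *)
Lemma history_expectationS n F : history_expectation n.+1 F =
  history_expectation n (fun s =>
    \sum_(k < N) gradPhiT a eta (Ghat a eta g s) k * F (k :: s)).
Proof.
rewrite /history_expectation.
under [RHS]eq_bigr do rewrite mulr_sumr.
rewrite pair_bigA/= (reindex (fun u : n.-tuple 'I_N * 'I_N => [tuple of u.2 :: u.1]))/=.
  by apply: eq_bigr => -[s k] _ /=; ring.
exists (fun t : n.+1.-tuple 'I_N => ([tuple of behead t], thead t)) => [[s k] _|t _] /=.
  by rewrite theadE; congr (_, _); exact: val_inj.
by rewrite -tuple_eta.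
Qed.

Lemma le_history_expectation n F1 F2 :
  (forall s, size s = n -> F1 s <= F2 s) ->
  history_expectation n F1 <= history_expectation n F2.
Proof.
move=> F12; apply: ler_sum => s _; rewrite ler_wpM2l ?histProb_ge0//.
by rewrite F12// size_tuple.
Qed.

Lemma history_expectationD_cst n F (B : R) :
  history_expectation n (fun s => F s + B) = history_expectation n F + B.
Proof.
suff E1 : history_expectation n (fun=> 1) = 1.
  rewrite -[X in _ + X]mul1r -[in RHS]E1 /history_expectation mulr_suml -big_split/=.
  by apply: eq_bigr => s _; ring.
elim: n => [|n IH]; first by rewrite history_expectation0.
rewrite history_expectationS -[RHS]IH; apply: eq_bigr => s _; congr (_ * _).
under eq_bigr do rewrite mulr1.
by have [] := gradPhiT_simplex N0 a01 eta0 (Ghat a eta g s).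
Qed.

Lemma history_expectation_potential_le i n :
  (forall t k, (t < n)%N -> -1 <= g t k <= 0) ->
  history_expectation n (history_potential i) <=
  PhiT a eta (fun _ : 'I_N => 0) + N%:R `^ a * n%:R / (2 * eta * a).
Proof.
elim: n => [|n IH] g01.
  by rewrite history_expectation0 /history_potential /= subr0 mulr0 mul0r.
rewrite history_expectationS.
apply: le_trans (le_history_expectation (F2 := fun s =>
  history_potential i s + N%:R `^ a / (2 * eta * a)) _) _.
  by move=> s sn; apply: history_potential_step => k; apply: g01; rewrite sn.
rewrite history_expectationD_cst -[n.+1%:R]natr1 mulrDr mulr1 mulrDl.
have /(_ _)/wrap[] := IH; first by move=> t k tn; apply: g01; exact: ltnW.
lra.
Qed.

(** The vertex [e_i] is a competitor of zero Tsallis entropy. *)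
Lemma Ghat_le_PhiT s i : Ghat a eta g s i <= PhiT a eta (Ghat a eta g s).
Proof.
set G := Ghat _ _ _ _; pose q j : R := (j == i)%:R.
have sq1 : \sum_(j < N) q j = 1.
  by rewrite (bigD1 i)//= big1 ?addr0 /q ?eqxx// => j /negbTE ->.
have sq : simplex q by split=> // j; rewrite /q; case: eqP.
have := PhiT_ge a01 eta0 G sq; rewrite /objective /tsallis.
rewrite [X in 1 - X](eq_bigr q) ?sq1; last first.
  move=> j _; rewrite /q; case: eqP => _; first by rewrite powR1.
  (* The value at [0] is [0] because [a] is nonzero; [0 to the power 0] would be [1]. *)
  by rewrite powR0// gt_eqF//; have := a01; lra.
rewrite subrr mul0r mulr0 subr0; apply: le_trans.
rewrite (bigD1 i)//= big1 ?addr0 /q ?eqxx ?mul1r// => j /negbTE ->.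
by rewrite mul0r.
Qed.

(** The losses are fixed in advance, so the best arm [m] is the same for every sampled history and
    the maximum leaves the expectation. *)
Lemma expected_regret_le_against n : exists i,
  expected_regret a eta n g <= history_expectation n (regret_against i).
Proof.
pose i0 := Ordinal N0.
case: (@Order.TotalTheory.arg_maxP _ _ _ i0 xpredT
  (fun i => \sum_(t < n) g t i) erefl) => m _ mmax.
have Gm j : \sum_(t < n) g t j <= \sum_(t < n) g t m by exact: mmax.
exists m; rewrite /expected_regret /history_expectation.
(* [expected_regret] sums over chronological tuples, [history_expectation] over newest-first ones;
   reversal matches the two sums. *)
have revtK : involutive (fun x : n.-tuple 'I_N => [tuple of rev x]).
  by move=> x; apply: val_inj; rewrite /= revK.
rewrite [leRHS](reindex_inj (inv_inj revtK))/=.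
apply: ler_sum => x _; rewrite ler_wpM2l ?histProb_ge0//.
apply: ge_sup; first by exists (\sum_(t < n) (g t m - g t (tnth x t))), m.
move=> _ [j _ <-]; rewrite regret_against_rev revK size_rev size_tuple.
rewrite !sumrB lerB//.
by rewrite le_eqVlt; apply/orP; left; apply/eqP/eq_bigr => t _; rewrite (tnth_nth m).
Qed.

End Histories.

Theorem theorem2 (R : realType) (N T : nat) (alpha eta : R)
  (g : nat -> 'I_N -> R) :
  (2 <= N)%N -> (1 <= T)%N -> 0 < alpha < 1 -> 0 < eta ->
  (forall (t : nat) (i : 'I_N), (t < T)%N -> -1 <= g t i <= 0) ->
  expected_regret alpha eta T g <=
    eta * ((N%:R `^ (1 - alpha) - 1) / (1 - alpha))
    + N%:R `^ alpha * T%:R / (2 * eta * alpha).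
Proof.
move=> N2 _ a01 eta0 g01; have N0 : (0 < N)%N by exact: leq_trans N2.
have [i /le_trans] := expected_regret_le_against g N0 a01 eta0 T; apply.
apply: (@le_trans _ _ (history_expectation alpha eta g T (history_potential alpha eta g i))).
  apply: le_history_expectation => // s _.
  by rewrite lerDr subr_ge0; exact: Ghat_le_PhiT.
apply: le_trans (history_expectation_potential_le N0 a01 eta0 i g01) _.
by rewrite lerD2r; exact: PhiT0_le.
Qed.
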